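(* Let $q$ be a prime power and use the setting described in the context. Let $\mathcal{L}_0$ be the set of planes obtained from the lifted Gabidulin code $\mathcal{L}$ by removing all planes $\Gamma_f$ with $f(x)=r(ux^q-u^qx)$ for some $r\in\mathbb{F}_{q^4}^\times$ and $u\in\mathbb{F}_{q^4}\setminus W$ (so that $\#\mathcal{L}_0=q^8-q^7+q^3$). Then $\mathcal{L}_0$ can be augmented by $(q^4-1)(q^3+q+1)$ new planes, each meeting $S$ in a point, with exactly $(q-1)(q^3+q+1)$ of them passing through any given point $P$ of $S$, to a plane subspace code $\mathcal{C}$ of size $\#\mathcal{C}=q^8+q^5+q^4-q-1$. Moreover, $\mathcal{C}$ may be chosen to be invariant under the group $\Sigma$.
   Context: $\mathbb{F}_{q^4}$ is the field with $q^4$ elements, viewed as a $4$-dimensional vector space over $\mathbb{F}_q$. Let $W=\{x\in\mathbb{F}_{q^4}: x+x^q+x^{q^2}+x^{q^3}=0\}$ (the trace-zero subspace, of $\mathbb{F}_q$-dimension $3$), $V=W\times\mathbb{F}_{q^4}$ (a $7$-dimensional $\mathbb{F}_q$-space) and $S=\{0\}\times\mathbb{F}_{q^4}$ (a $4$-dimensional subspace). Points, lines, planes of $V$ are its $\mathbb{F}_q$-subspaces of dimension $1,2,3$. A plane subspace code is a set of planes of $V$ any two distinct members of which intersect in a subspace of dimension at most $1$. For an $\mathbb{F}_q$-linear map $f\colon W\to\mathbb{F}_{q^4}$ let $\Gamma_f=\{(x,f(x)):x\in W\}$. The Gabidulin code is $\mathcal{G}=\{f\colon W\to\mathbb{F}_{q^4},\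 x\mapsto a_0x+a_1x^q : a_0,a_1\in\mathbb{F}_{q^4}\}$ and the lifted Gabidulin code is $\mathcal{L}=\{\Gamma_f: f\in\mathcal{G}\}$ (a set of $q^8$ planes). $\Sigma$ is the group of $\mathbb{F}_q$-linear maps $V\to V$, $(x,y)\mapsto(x,ry)$ with $r\in\mathbb{F}_{q^4}^\times$; a set of planes is $\Sigma$-invariant if it is mapped to itself by every element of $\Sigma$. *)

(* Defs.v *)
From HB Require Import structures.
From mathcomp Require Import all_boot all_order all_algebra all_fingroup all_field.

Set Implicit Arguments.
Unset Strict Implicit.
Unset Printing Implicit Defensive.

Import GRing.Theory.
Local Open Scope ring_scope.

(* Over a finite field, subspaces and linear maps form finite types, so sets  *)
(* of them have type {set _} and cardinality #|_|.                            *)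
Section Finiteness.

Import VectorInternalTheory.

Variables (F : finFieldType) (vT rT : vectType F).

HB.instance Definition _ := [Countable of {vspace vT} by <:].
HB.instance Definition _ := [Finite of {vspace vT} by <:].
HB.instance Definition _ := [Countable of 'Hom(vT, rT) by <:].
HB.instance Definition _ := [Finite of 'Hom(vT, rT) by <:].

End Finiteness.

Section Setting.

(* F is the field with q elements and L an extension of F; degree 4 is only   *)
(* required in theorems. finvect_type L is L with its finite type structure.  *)
Variables (F : finFieldType) (L : fieldExtType F).
Local Notation q := #|F|.
Local Notation finL := (finvect_type L).

Lemma exprq_linear (a : F) (x y : L) :
  (a *: x + y) ^+ q = a *: x ^+ q + y ^+ q.
Proof.
have [p p_pr pcharFp] := finPcharP F.
have pL : p \in [pchar L] by rewrite (pchar_lalg L).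
rewrite exprDn_pchar ?exprZn ?expf_card //.
by rewrite (card_pprimeChar pcharFp) (eq_pnat _ (pcharf_eq pL)) pnatX pnat_id.
Qed.

Lemma exprqX_linear n (a : F) (x y : L) :
  (a *: x + y) ^+ (q ^ n) = a *: x ^+ (q ^ n) + y ^+ (q ^ n).
Proof.
by elim: n => [|n IHn]; rewrite ?expr1 // expnSr !exprM IHn exprq_linear.
Qed.

Definition tr4 (x : L) : L := x + x ^+ q + x ^+ (q ^ 2) + x ^+ (q ^ 3).

Fact tr4_is_linear : linear tr4.
Proof.
move=> a x y; rewrite /tr4 exprq_linear !exprqX_linear !scalerDr.
by rewrite (addrACA _ y) (addrACA _ (y + _)) (addrACA _ (y + _ + _)).
Qed.
HB.instance Definition _ := GRing.isLinear.Build F L L *:%R tr4 tr4_is_linear.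

Definition W : {vspace L} := lker (linfun tr4).

Lemma mem_W x : (x \in W) = (x + x ^+ q + x ^+ (q ^ 2) + x ^+ (q ^ 3) == 0).
Proof. by rewrite memv_ker lfunE. Qed.

Definition V : vectType F := (subvs_of W * L)%type.

Definition inS (y : L) : V := (0, y).

Fact inS_is_linear : linear inS.
Proof. by move=> a x y; congr (_, _); rewrite /= scaler0 addr0. Qed.
HB.instance Definition _ := GRing.isLinear.Build F L V *:%R inS inS_is_linear.

Definition S : {vspace V} := limg (linfun inS).

Lemma mem_S (v : V) : (v \in S) = (v.1 == 0).
Proof.
apply/memv_imgP/eqP=> [[y _ ->] | v1_0]; first by rewrite lfunE.
by exists v.2; rewrite ?memvf // lfunE /= /inS -v1_0; case: (v).
Qed.

Section Graph.

Variable f : 'Hom(subvs_of W, L).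

Definition graph_fun (x : subvs_of W) : V := (x, f x).

Fact graph_fun_is_linear : linear graph_fun.
Proof. by move=> a x y; congr (_, _); rewrite /= linearP. Qed.
HB.instance Definition _ :=
  GRing.isLinear.Build F (subvs_of W) V *:%R graph_fun graph_fun_is_linear.

Definition Gamma : {vspace V} := limg (linfun graph_fun).

Lemma mem_Gamma (v : V) : (v \in Gamma) = (v.2 == f v.1).
Proof.
apply/memv_imgP/eqP=> [[x _ ->] | v2E]; first by rewrite lfunE.
by exists v.1; rewrite ?memvf // lfunE /= /graph_fun -v2E; case: (v).
Qed.

End Graph.

Definition gabidulin : {set 'Hom(subvs_of W, L)} :=
  [set f : 'Hom(subvs_of W, L) | [exists a0 : finL, exists a1 : finL,
     forall x : finvect_type (subvs_of W),
       (f x : L) == (a0 : L) * vsval x + (a1 : L) * vsval x ^+ q]].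

Definition lifted_gabidulin : {set {vspace V}} := [set Gamma f | f in gabidulin].

Definition removed_maps : {set 'Hom(subvs_of W, L)} :=
  [set f : 'Hom(subvs_of W, L) | [exists r : finL, exists u : finL,
     [&& r != 0, (u : L) \notin W &
       [forall x : finvect_type (subvs_of W),
         (f x : L) == (r : L) * ((u : L) * vsval x ^+ q - (u : L) ^+ q * vsval x)]]]].

Definition L0 : {set {vspace V}} :=
  lifted_gabidulin :\: [set Gamma f | f in removed_maps].

Definition plane_code (C : {set {vspace V}}) : Prop :=
  {in C, forall E, \dim E = 3%N} /\
  {in C &, forall E E', E != E' -> \dim (E :&: E') <= 1}%N.

Definition sigma_fun (r : L) (v : V) : V := (v.1, r * v.2).

Fact sigma_fun_is_linear r : linear (sigma_fun r).
Proof. by move=> a x y; congr (_, _); rewrite /= mulrDr scalerAr. Qed.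
HB.instance Definition _ r :=
  GRing.isLinear.Build F V V *:%R (sigma_fun r) (sigma_fun_is_linear r).

Definition sigma (r : L) : 'End(V) := linfun (sigma_fun r).

Definition Sigma_invariant (C : {set {vspace V}}) : Prop :=
  forall r : L, r != 0 -> [set (sigma r @: E)%VS | E : {vspace V} in C] = C.

End Setting.

(* Main.v *)
From HB Require Import structures.
Require Import Defs.
From mathcomp Require Import all_boot all_order all_algebra all_fingroup all_field.
From mathcomp Require Import cyclic ring zify.

(* Write [x_i] for [x ^+ (q ^ i)].  The new planes are                        *)
(*   E(rho, g) = {(x, rho y) | tr4 x = 0, tr4 (g x_3) = 0, y + y_1 = c x_1}   *)
(* with [c = gam g = g / ((g - g_3) (g - g_1))] and [g] outside F.  On the    *)
(* two-dimensional space of the first coordinates, every solution [y] linear  *)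
(* in [x] has the form [(u x_1 - u_1 x) / (g - g_3)] with [tr4 u = 1], so a   *)
(* line of E(rho, g) disjoint from S lies on a removed plane, and one such    *)
(* line determines (rho, g) up to a common factor in F.  Two new planes that  *)
(* share a line meeting S have, after rescaling, the same [rho] and then the  *)
(* same [gam g].  Hence the new planes form a code as soon as [g] is taken in *)
(* a set on which [gam] is injective.  Since [gam g] is [a g_2 + b] with      *)
(* [a_1 = - a], [b_1 = - b], this holds where [a != 0], which amounts to      *)
(* [g g_2 != g_1 g_3]; and [gam] is also injective on the multiples by F of a *)
(* single [t] with [t t_2 = t_1 t_3].  The equation [g g_2 = g_1 g_3] has     *)
(* [q ^ 3 - q ^ 2 + q] solutions, which leaves [(q - 1) (q ^ 3 + q + 1)]      *)
(* admissible values of [g].                                                  *)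

Set Implicit Arguments.
Unset Strict Implicit.
Unset Printing Implicit Defensive.

Import GRing.Theory.
Local Open Scope ring_scope.

(** A line of [V] disjoint from [S] lies on exactly one lifted Gabidulin plane, since the map
    [a0 x + a1 x_1] is determined by its values at two independent points, and these can be
    prescribed ([interpolate], [gab_eq_on_wedge]). New planes must therefore use only lines freed by
    the removal: [new_line_removed] shows that they do, [new_line_unique] that no freed line is used
    twice. Lifted planes avoid the points of [S], so a line meeting [S] can only be shared by two
    new planes; the common point of [S] fixes [rho] up to F ([new_plane_point]), and [gam_inj_good]
    then separates the planes.

    The equations have solutions above the whole two-dimensional base because [gam_decomp] makes the
    compatibility condition a combination of the two trace equations ([alt4_gam]). Elements of
    [Sigma] multiply [rho] and fix [g], whence the invariance. Both counts rest on [card_good] and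
    on [new_plane_eq]: a plane determines [(rho, g)] up to a common factor in F. *)

(** * Frobenius, q-polynomials and trace kernels *)

Section Frobenius.

Variables (F : finFieldType) (L : fieldExtType F).
Local Notation q := #|F|.
Local Notation finL := (finvect_type L).

Lemma card_vspaceE (vT : vectType F) (U : {vspace vT}) :
  #|[pred x : finvect_type vT | (x : vT) \in U]| = (q ^ \dim U)%N.
Proof.
case: vT U => T c U.
exact: (card_vspace (T := finvect_type (Vector.Pack c)) U).
Qed.

Lemma dim_root_le (U : {vspace L}) (p : {poly L}) d :
  p != 0 -> (size p <= (q ^ d).+1)%N -> {in U, forall x, root p x} ->
  (\dim U <= d)%N.
Proof.
move=> p_neq0 sz_p rootU; rewrite -(leq_exp2l _ _ (finNzRing_gt1 F)) -ltnS.
apply: leq_trans sz_p; rewrite -card_vspaceE cardE.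
apply: (max_poly_roots p_neq0); last exact: enum_uniq.
by apply/allP=> x; rewrite (mem_enum (T := finL)); apply: rootU.
Qed.

Definition frob (x : L) : L := x ^+ q.

Fact frob_is_linear : linear frob.
Proof. exact: exprq_linear. Qed.
HB.instance Definition _ := GRing.isLinear.Build F L L *:%R frob frob_is_linear.

Fact frob_is_monoid_morphism : monoid_morphism frob.
Proof. by split=> [|x y]; rewrite /frob ?expr1n ?exprMn. Qed.
HB.instance Definition _ :=
  GRing.isMonoidMorphism.Build L L frob frob_is_monoid_morphism.

Lemma frob_eq0 x : (frob x == 0) = (x == 0).
Proof. exact: fmorph_eq0. Qed.

Lemma frob_fixed x : reflect (exists a : F, x = a%:A) (frob x == x).
Proof.
have := Fermat's_little_theorem 1%AS x; rewrite dimv1 expn1 => <-.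
by apply: (iffP (vlineP _ _)).
Qed.

Lemma frob_scalar (a : F) : frob a%:A = a%:A.
Proof. by apply/eqP/frob_fixed; exists a. Qed.

Lemma tr4E x :
  tr4 x = x + frob x + frob (frob x) + frob (frob (frob x)).
Proof. by rewrite /tr4 /frob !expnSr expn0 mul1n !exprM. Qed.

Lemma iter_frob n x : iter n frob x = x ^+ (q ^ n).
Proof. by elim: n => [|n IHn]; rewrite ?expr1 // iterS IHn /frob -exprM expnSr. Qed.

(** A q-polynomial with [n] coefficients has degree at most [q ^ (n - 1)]. The kernels below are
    bounded this way, and rank-nullity then gives exact dimensions. *)
Lemma dim_qpoly_le (U : {vspace L}) (c : seq L) :
  has (predC1 0) c ->
  {in U, forall x, \sum_(i < size c) c`_i * iter i frob x = 0} ->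
  (\dim U <= (size c).-1)%N.
Proof.
case/(has_nthP 0)=> i i_lt /= ci_neq0 rootU.
pose p := \sum_(j < size c) c`_j *: 'X^(q ^ j) : {poly L}.
have q_gt1 := finNzRing_gt1 F.
apply: (@dim_root_le _ p) => [||x Ux].
- apply: contraNneq ci_neq0 => p0; move: (coef0 L (q ^ i)); rewrite -p0 coef_sum.
  rewrite (bigD1 (Ordinal i_lt)) //= coefZ coefXn eqxx mulr1 big1 ?addr0 => [->//|].
  move=> j; rewrite -val_eqE /= => /negPf ne_ji.
  by rewrite coefZ coefXn eqn_exp2l // eq_sym ne_ji mulr0.
- apply: leq_trans (size_sum _ _ _) _; apply/bigmax_leqP=> j _.
  apply: leq_trans (size_scale_leq _ _) _; rewrite size_polyXn ltnS leq_exp2l //.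
  by rewrite -ltnS (ltn_predK i_lt).
rewrite rootE horner_sum -[X in _ == X](rootU _ Ux); apply/eqP.
by apply: eq_bigr => j _; rewrite hornerZ hornerXn iter_frob.
Qed.

Hypothesis dimL : \dim {:L} = 4%N.

Lemma card_L : #|finL| = (q ^ 4)%N.
Proof. by rewrite -dimL -card_vspaceE; apply: eq_card => x; rewrite inE memvf. Qed.

Lemma frob4 x : frob (frob (frob (frob x))) = x.
Proof.
have xq4: x ^+ (q ^ 4) = x.
  by have := Fermat's_little_theorem {:L}%AS x; rewrite memvf dimL => /esym/eqP.
by rewrite -[RHS]xq4 /frob !expnSr expn0 mul1n !exprM.
Qed.

Lemma frob_tr4 x : frob (tr4 x) = tr4 x.
Proof. rewrite tr4E !rmorphD /= frob4; ring. Qed.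

Lemma tr4_normalize (x : L) : tr4 x != 0 -> tr4 (x / tr4 x) = 1.
Proof.
have ft := frob_tr4 x => t_neq0; rewrite [LHS]tr4E.
do 3!rewrite fmorph_div /= ft.
by rewrite -!mulrDl -tr4E divff.
Qed.

(** The alternating trace. It cuts out the image of [frobD1], and [alt4 (c * z) = c * tr4 z]
    whenever [c_1 = - c]. *)
Definition alt4 (x : L) : L :=
  x - frob x + frob (frob x) - frob (frob (frob x)).

Fact alt4_is_linear : linear alt4.
Proof.
move=> a x y; rewrite -[a *: x]mulr_algl -[a *: alt4 x]mulr_algl /alt4.
rewrite !rmorphD !rmorphM /= !frob_scalar; ring.
Qed.
HB.instance Definition _ := GRing.isLinear.Build F L L *:%R alt4 alt4_is_linear.

Definition frobD1 : 'End(L) := (\1 + linfun frob)%VF.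

Lemma frobD1E x : frobD1 x = x + frob x.
Proof. by rewrite /frobD1 add_lfunE id_lfunE lfunE. Qed.

Lemma dim_W : \dim (W L) = 3%N.
Proof.
apply/eqP; rewrite eqn_leq; apply/andP; split.
  apply: (@dim_qpoly_le _ [:: 1; 1; 1; 1]) => [|x]; first by rewrite /= oner_eq0.
  rewrite memv_ker lfunE /= tr4E => /eqP tr0.
  by rewrite -[RHS]tr0 !big_ord_recl big_ord0 /=; ring.
(* The trace of [x_1 - x] telescopes to 0, and this map has a kernel of dimension at most 1, so [W]
   has dimension at least 3. *)
pose d : 'End(L) := (linfun frob - \1)%VF.
have dE x : d x = frob x - x by rewrite /d add_lfunE opp_lfunE id_lfunE lfunE.
have := limg_ker_dim d fullv; rewrite dimL capfv => dim_d.
have : (\dim (lker d) <= 1)%N.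
  apply: (@dim_qpoly_le _ [:: -1; 1]) => [|x].
    by rewrite /= oner_eq0 orbT.
  rewrite memv_ker dE => /eqP dx.
  by rewrite -[RHS]dx !big_ord_recl big_ord0 /=; ring.
have : (\dim (limg d) <= \dim (W L))%N.
  apply/dimvS/subvP=> _ /memv_imgP[x _ ->].
  rewrite memv_ker lfunE /= tr4E dE !rmorphB /= frob4; apply/eqP; ring.
by move: dim_d; lia.
Qed.

(* The kernel has dimension at most 1 and [lker alt4] dimension at most 3, by *)
(* the degrees of the q-polynomials, and 1 + 3 = 4 forces equality.           *)
Fact frobD1_dims : \dim (lker frobD1) = 1%N /\ limg frobD1 = lker (linfun alt4).
Proof.
have := limg_ker_dim frobD1 fullv; rewrite dimL capfv => dim_frobD1.
have ker_le : (\dim (lker frobD1) <= 1)%N.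
  apply: (@dim_qpoly_le _ [:: 1; 1]) => [|x]; first by rewrite /= oner_eq0.
  rewrite memv_ker frobD1E => /eqP sx.
  by rewrite -[RHS]sx !big_ord_recl big_ord0 /=; ring.
have alt_le : (\dim (lker (linfun alt4)) <= 3)%N.
  apply: (@dim_qpoly_le _ [:: 1; -1; 1; -1]) => [|x].
    by rewrite /= oner_eq0.
  rewrite memv_ker lfunE /= => /eqP altx.
  by rewrite -[RHS]altx !big_ord_recl big_ord0 /= /alt4; ring.
have sub : (limg frobD1 <= lker (linfun alt4))%VS.
  apply/subvP=> _ /memv_imgP[x _ ->].
  rewrite memv_ker lfunE /= /alt4 frobD1E !rmorphD /= frob4; apply/eqP; ring.
have := dimvS sub => img_le; split; first by lia.
by apply/eqP; rewrite eqEdim sub; lia.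
Qed.

Lemma dim_ker_frobD1 : \dim (lker frobD1) = 1%N.
Proof. by have [] := frobD1_dims. Qed.

Lemma limg_frobD1 : limg frobD1 = lker (linfun alt4).
Proof. by have [] := frobD1_dims. Qed.

End Frobenius.

Lemma cramer2_eq0 (K : fieldType) (a b x y z t : K) :
  x * t - y * z != 0 -> a * x + b * y = 0 -> a * z + b * t = 0 ->
  a = 0 /\ b = 0.
Proof.
move=> det_neq0 e1 e2; split; apply: (mulIf det_neq0); rewrite mul0r.
  transitivity ((a * x + b * y) * t - (a * z + b * t) * y); first by ring.
  by rewrite e1 e2 !mul0r subrr.
transitivity ((a * z + b * t) * x - (a * x + b * y) * z); first by ring.
by rewrite e1 e2 !mul0r subrr.
Qed.

(** * The function [gam] and its injectivity *)

Section GammaValue.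

Variables (F : finFieldType) (L : fieldExtType F).
Hypothesis dimL : \dim {:L} = 4%N.
Implicit Types g h u x z r : L.

Let frobK := frob4 dimL.

Definition gam g := g / ((g - frob (frob (frob g))) * (g - frob g)).

(** With [n = g * g_2] this is [n - n_1]: it vanishes exactly when the norm of [g] to the quadratic
    subfield lies in F. *)
Definition skew_disc g := g * frob (frob g) - frob g * frob (frob (frob g)).

Definition tr_pair g x := tr4 (g * frob (frob (frob x))).

Lemma tr_pairE g x :
  tr_pair g x = g * frob (frob (frob x)) + frob g * x
    + frob (frob g) * frob x + frob (frob (frob g)) * frob (frob x).
Proof. by rewrite /tr_pair tr4E !rmorphM /= !frobK. Qed.

Lemma frob_fix_trans g : frob g != g ->
  [/\ g - frob g != 0, frob g - frob (frob g) != 0,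
      frob (frob g) - frob (frob (frob g)) != 0 &
      frob (frob (frob g)) - g != 0].
Proof.
move=> g_nF; have d0 : g - frob g != 0 by rewrite subr_eq0 eq_sym.
by split=> //; rewrite -?[X in _ - X != 0](frobK g) -!rmorphB !frob_eq0.
Qed.

Lemma gam_neq0 g : frob g != g -> gam g != 0.
Proof.
move=> g_nF; have [d0 _ _ d3] := frob_fix_trans g_nF.
rewrite /gam mulf_neq0 ?invr_eq0 ?mulf_neq0 //; last by rewrite -opprB oppr_eq0.
by apply: contraNneq g_nF => ->; rewrite rmorph0.
Qed.

Lemma gam_scale c g : frob c = c -> c != 0 -> gam (c * g) = gam g / c.
Proof.
move=> c_F c_neq0; rewrite /gam !rmorphM /= !c_F -!mulrBr.
rewrite !invfM; move: (g - _)^-1 (g - frob g)^-1 => a b.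
by rewrite -[RHS]mulr1 -(divff c_neq0); ring.
Qed.

Lemma frob_gam_skew g :
  frob g != g -> (frob (gam g) == - gam g) = (skew_disc g == 0).
Proof.
move=> g_nF; have [d0 d1 d2 d3] := frob_fix_trans g_nF.
have d3' : g - frob (frob (frob g)) != 0 by rewrite -opprB oppr_eq0.
have d0' : frob g - g != 0 by rewrite -opprB oppr_eq0.
have -> : skew_disc g = - ((frob (gam g) + gam g)
   * ((g - frob g) * (frob g - frob (frob g)) * (g - frob (frob (frob g))))).
  rewrite /gam fmorph_div /= rmorphM !rmorphB /= frobK /skew_disc.
  by field; rewrite d0 d0' d1 d3'.
by rewrite oppr_eq0 !mulf_eq0 (negPf d0) (negPf d1) (negPf d3') !orbF addr_eq0.
Qed.

(** Over the denominator [N], the norm of [g - g_1], the numerators [skew_disc g] and [C] both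
    change sign under [frob]. *)
Lemma gam_decomp g : frob g != g -> exists c d,
  [/\ frob c = - c, frob d = - d & gam g = c * frob (frob g) + d].
Proof.
move=> g_nF; have [d0 d1 d2 d3] := frob_fix_trans g_nF.
have d3' : g - frob (frob (frob g)) != 0 by rewrite -opprB oppr_eq0.
pose N := (g - frob g) * (frob g - frob (frob g))
  * (frob (frob g) - frob (frob (frob g))) * (frob (frob (frob g)) - g).
pose C := frob g * frob (frob g) * frob (frob (frob g))
  - g * frob (frob g) * frob (frob (frob g))
  + g * frob g * frob (frob (frob g)) - g * frob g * frob (frob g).
have fN : frob N = N by rewrite /N !(rmorphB, rmorphM) /= frobK; ring.
have N_neq0 : N != 0 by rewrite !mulf_neq0.
have fC : frob C = - C.
  by rewrite /C !(rmorphB, rmorphD, rmorphM) /= frobK; ring.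
exists (skew_disc g / N), (C / N); split.
- rewrite fmorph_div /= fN /skew_disc !(rmorphB, rmorphM) /= frobK; ring.
- by rewrite fmorph_div /= fN fC mulNr.
by rewrite /gam /skew_disc /C /N; field; rewrite d0 d1 d2 d3 d3'.
Qed.

(* Comparing the decompositions [a * g ^+ (q ^ 2) + b] of the two values of   *)
(* [gam] gives [h = c * g + d] with [c] and [d] in F.                         *)
Lemma gam_inj_generic g h :
  frob g != g -> frob h != h -> skew_disc g != 0 -> gam g = gam h -> g = h.
Proof.
move=> g_nF h_nF Bg_neq0 eq_gam.
have [dg0 _ _ dg3] := frob_fix_trans g_nF.
have [dh0 _ _ dh3] := frob_fix_trans h_nF.
have [c [d [c_neq0 c_F d_F hE]]] : exists c d,
    [/\ c != 0, frob c = c, frob d = d & h = c * g + d].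
  have [a [b [fa fb gE]]] := gam_decomp g_nF.
  have [a' [b' [fa' fb' hE]]] := gam_decomp h_nF.
  have a_neq0 : a != 0.
    apply: contraNneq Bg_neq0 => a0.
    by rewrite -frob_gam_skew // gE a0 mul0r add0r fb.
  have a'_neq0 : a' != 0.
    apply: contraNneq Bg_neq0 => a0.
    by rewrite -frob_gam_skew // eq_gam hE a0 mul0r add0r fb'.
  have c_F : frob (a / a') = a / a'.
    by rewrite fmorph_div /= fa fa' mulNr invrN mulrN opprK.
  have d_F : frob ((b - b') / a') = (b - b') / a'.
    by rewrite fmorph_div rmorphB /= fb fb' fa'; field; rewrite ?oppr_eq0 a'_neq0.
  exists (a / a'), ((b - b') / a').
  split=> //; first by rewrite mulf_neq0 ?invr_eq0.
  have h2E : frob (frob h) = a / a' * frob (frob g) + (b - b') / a'.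
    have -> : b = gam h - a * frob (frob g) by rewrite -eq_gam gE; ring.
    by rewrite hE; field.
  rewrite -[LHS]frobK h2E rmorphD rmorphM /= c_F d_F.
  by rewrite rmorphD rmorphM /= c_F d_F frobK.
(* Adding [d] leaves differences of conjugates unchanged and [c] scales them, so equal values of
   [gam] mean [c ^+ 2 * g = h]. *)
have {}eq_gam : c * (c - 1) * g = d.
  have fh : frob h = c * frob g + d by rewrite hE rmorphD rmorphM /= c_F d_F.
  have ffh : frob (frob h) = c * frob (frob g) + d.
    by rewrite fh rmorphD rmorphM /= c_F d_F.
  have fffh : frob (frob (frob h)) = c * frob (frob (frob g)) + d.
    by rewrite ffh rmorphD rmorphM /= c_F d_F.
  have dg3' : g - frob (frob (frob g)) != 0 by rewrite -opprB oppr_eq0.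
  have dh3' : h - frob (frob (frob h)) != 0 by rewrite -opprB oppr_eq0.
  move/eqP: eq_gam; rewrite eqr_div ?mulf_neq0 // fffh fh hE => /eqP eq_gam.
  apply: (mulIf (mulf_neq0 dg3' dg0)); apply/eqP; rewrite -subr_eq0; apply/eqP.
  by rewrite -[RHS](subrr (g * ((c * g + d - (c * frob (frob (frob g)) + d))
    * (c * g + d - (c * frob g + d))))) {2}eq_gam; ring.
have [c1|c_neq1] := eqVneq c 1.
  by rewrite hE -eq_gam c1 subrr mulr0 mul0r mul1r addr0.
case/negP: g_nF; apply/eqP.
have c1_neq0 : c * (c - 1) != 0 by rewrite mulf_neq0 ?subr_eq0.
rewrite -[g](mulKf c1_neq0) eq_gam rmorphM fmorphV !(rmorphM, rmorphB) /=.
by rewrite rmorph1 c_F d_F.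
Qed.

End GammaValue.

(** * Lines of new planes that are disjoint from [S] *)

Section Lines.

Variables (F : finFieldType) (L : fieldExtType F).
Hypothesis dimL : \dim {:L} = 4%N.
Implicit Types g h u x z r rho : L.

Let frobK := frob4 dimL.

(** The shift by [x_3] in [tr_pair] cancels the [x_3] terms. On the first coordinates of a new plane
    the right side is 0, which expresses [x_2] through [x] and [x_1]. *)
Lemma tr_pair_qpoly g x :
  (g - frob (frob (frob g))) * frob (frob x)
    + (g - frob (frob g)) * frob x + (g - frob g) * x
  = g * tr4 x - tr_pair g x.
Proof. rewrite tr_pairE // tr4E; ring. Qed.

(** Here [w = rho y]. The condition [tr4 x = 0] is spelled out because [x] ranges over [L]; for
    vectors of [V] the type carries it. *)
Definition in_new rho g x w :=
  [&& tr4 x == 0, tr_pair g x == 0 & w / rho + frob (w / rho) == gam g * frob x].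

(** Eliminating [x_2] by [tr_pair_qpoly] leaves a combination of [x] and [x_1] that vanishes at two
    independent points, so both coefficients are 0. The first derives [a0] and [a1] from a single
    [u]; the second becomes [g = g * tr4 u - tr_pair g u], and subtracting its image under [frob]
    isolates [tr4 u = 1]. *)
Lemma new_line_removed rho g a0 a1 x z :
    rho != 0 -> frob g != g -> x * frob z - frob x * z != 0 ->
    in_new rho g x (a0 * x + a1 * frob x) ->
    in_new rho g z (a0 * z + a1 * frob z) ->
  exists u, [/\ tr4 u = 1, tr_pair g u = 0,
    a1 = rho / (g - frob (frob (frob g))) * u &
    a0 = - (rho / (g - frob (frob (frob g))) * frob u)].
Proof.
move=> rho_neq0 g_nF xz_neq0 new_x new_z.
have [d0 d1 d2 d3] := frob_fix_trans dimL g_nF.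
set k := g - frob (frob (frob g)).
have k_neq0 : k != 0 by rewrite /k -opprB oppr_eq0.
have fk : frob k = - (g - frob g) by rewrite /k rmorphB /= frobK opprB.
have fk_neq0 : frob k != 0 by rewrite frob_eq0.
pose b0 := a0 / rho; pose b1 := a1 / rho.
have a0E : a0 = rho * b0 by rewrite mulrC divfK.
have a1E : a1 = rho * b1 by rewrite mulrC divfK.
have elim y : in_new rho g y (a0 * y + a1 * frob y) ->
  (k * b0 + frob b1 * frob k) * y
    + (k * (b1 + frob b0 - gam g) - frob b1 * (g - frob (frob g))) * frob y = 0.
  case/and3P=> /eqP tr_y /eqP pair_y /eqP eq_y.
  have := tr_pair_qpoly g y; rewrite tr_y pair_y mulr0 subr0 -/k => qy.
  have {}eq_y : b0 * y + b1 * frob y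
      + (frob b0 * frob y + frob b1 * frob (frob y)) = gam g * frob y.
    rewrite -eq_y; have -> : (a0 * y + a1 * frob y) / rho = b0 * y + b1 * frob y.
      by rewrite /b0 /b1; ring.
    by rewrite rmorphD !rmorphM.
  rewrite fk.
  transitivity (k * (b0 * y + b1 * frob y
      + (frob b0 * frob y + frob b1 * frob (frob y)) - gam g * frob y)
    - frob b1 * (k * frob (frob y) + (g - frob (frob g)) * frob y
         + (g - frob g) * y)); first by ring.
  by rewrite eq_y qy subrr !mulr0 subrr.
have [|e0 e1] := cramer2_eq0 _ (elim _ new_x) (elim _ new_z).
  exact: xz_neq0.
pose u := k * b1.
have fu : frob u = - (k * b0).
  apply/eqP; rewrite -subr_eq0 opprK; apply/eqP; rewrite -e0 /u rmorphM; ring.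
have b0E : b0 = - (frob u / k) by rewrite fu mulNr opprK mulrC mulKf.
have b1E : b1 = u / k by rewrite /u mulrC mulKf.
have gam_g : gam g * (k * frob k) = - g.
  rewrite /gam -/k -[g - frob g]opprK -fk.
  by field; rewrite ?oppr_eq0 k_neq0 fk_neq0.
(* [g] is the value at [u] of the [q]-polynomial of [tr_pair_qpoly]. *)
have gE : g = g * tr4 u - tr_pair g u.
  rewrite -tr_pair_qpoly -/k.
  have := congr1 ( *%R (frob k)) e1.
  rewrite mulr0 b0E b1E rmorphN !fmorph_div /= => e.
  apply/eqP; rewrite -subr_eq0 -[X in _ == X]e; apply/eqP.
  have -> : frob k * (k * (u / k + - (frob (frob u) / frob k) - gam g) -
      frob u / frob k * (g - frob (frob g)))
    = frob k * u - k * frob (frob u) - gam g * (k * frob k)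
      - frob u * (g - frob (frob g)).
    by field; rewrite fk_neq0 k_neq0.
  by rewrite gam_g fk; ring.
have tr_u : tr4 u = 1.
  have := congr1 (@frob F L) gE; rewrite rmorphB rmorphM /= !(frob_tr4 dimL) => fgE.
  have e : (g - frob g) * tr4 u = (g - frob g) * 1.
    transitivity (g * tr4 u - tr_pair g u - (frob g * tr4 u - tr_pair g u)).
      by ring.
    by rewrite -gE -fgE mulr1.
  exact: mulfI e.
exists u; split=> //.
- by have := gE; rewrite tr_u mulr1 -{1}[g]subr0 => /subrI.
- by rewrite a1E b1E; ring.
by rewrite a0E b0E; ring.
Qed.

(** The two parameters [u] and [v] differ by a factor in F, which is 1 because both have trace 1.
    The q-polynomials of [g] and [h] share the zeros [x] and [z], which gives [h = c * g + e] with
    [c], [e] in F; pairing with [u] shows [e = 0]. *)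
Lemma new_line_unique rho g sig h a0 a1 x z :
    rho != 0 -> sig != 0 -> frob g != g -> frob h != h ->
    x * frob z - frob x * z != 0 ->
    in_new rho g x (a0 * x + a1 * frob x) ->
    in_new rho g z (a0 * z + a1 * frob z) ->
    in_new sig h x (a0 * x + a1 * frob x) ->
    in_new sig h z (a0 * z + a1 * frob z) ->
  exists c, [/\ c != 0, frob c = c, sig = c * rho & h = c * g].
Proof.
move=> rho_neq0 sig_neq0 g_nF h_nF xz_neq0 gx gz hx hz.
have [u [tr_u g_u ua1 ua0]] := new_line_removed rho_neq0 g_nF xz_neq0 gx gz.
have [v [tr_v h_v va1 va0]] := new_line_removed sig_neq0 h_nF xz_neq0 hx hz.
have [g0 g1 g2 g3] := frob_fix_trans dimL g_nF.
have [h0 h1 h2 h3] := frob_fix_trans dimL h_nF.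
set k := g - frob (frob (frob g)) in ua1 ua0.
set l := h - frob (frob (frob h)) in va1 va0.
have k_neq0 : k != 0 by rewrite /k -opprB oppr_eq0.
have l_neq0 : l != 0 by rewrite /l -opprB oppr_eq0.
have fk : frob k = - (g - frob g) by rewrite /k rmorphB /= frobK opprB.
have fl : frob l = - (h - frob h) by rewrite /l rmorphB /= frobK opprB.
have u_neq0 : u != 0.
  by apply: contraPneq tr_u => ->; rewrite linear0 => /esym/eqP; rewrite oner_eq0.
have sl_neq0 : sig / l != 0 by rewrite mulf_neq0 ?invr_eq0.
pose m := rho / k / (sig / l).
have mE : rho / k = m * (sig / l) by rewrite divfK.
clearbody m.
have vE : v = m * u.
  by apply: (mulfI sl_neq0); rewrite -va1 ua1 mE; ring.
have fm : frob m = m.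
  have fu_neq0 : sig / l * frob u != 0 by rewrite mulf_neq0 ?frob_eq0.
  apply: (mulfI fu_neq0); transitivity (sig / l * frob v).
    by rewrite vE rmorphM /=; ring.
  by apply: oppr_inj; rewrite -va0 ua0 mE; ring.
have m1 : m = 1.
  by rewrite -tr_v vE tr4E !rmorphM /= !fm -!mulrDr -tr4E tr_u mulr1.
have {}mE : rho / k = sig / l by rewrite mE m1 mul1r.
have elim y w w' : in_new rho g y w -> in_new sig h y w' ->
  (l * (g - frob g) - k * (h - frob h)) * y
    + (l * (g - frob (frob g)) - k * (h - frob (frob h))) * frob y = 0.
  case/and3P=> /eqP tr_y /eqP gy _ /and3P[_ /eqP hy _].
  have := tr_pair_qpoly g y; rewrite tr_y gy mulr0 subr0 -/k => qg.
  have := tr_pair_qpoly h y; rewrite tr_y hy mulr0 subr0 -/l => qh.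
  transitivity (l * (k * frob (frob y) + (g - frob (frob g)) * frob y
      + (g - frob g) * y)
    - k * (l * frob (frob y) + (h - frob (frob h)) * frob y
      + (h - frob h) * y)); first by ring.
  by rewrite qg qh !mulr0 subrr.
have [|e0 _] := cramer2_eq0 _ (elim _ _ _ gx hx) (elim _ _ _ gz hz).
  exact: xz_neq0.
pose c := l / k.
have lE : l = c * k by rewrite divfK.
have c_neq0 : c != 0 by rewrite mulf_neq0 ?invr_eq0.
have fc : frob c = c.
  rewrite /c fmorph_div /=; apply/eqP; rewrite eqr_div ?frob_eq0 // -subr_eq0 fk fl.
  by rewrite -[X in _ == X]e0; apply/eqP; ring.
pose e := h - c * g.
have fe : frob e = e.
  have e1 : h - frob h = c * (g - frob g).
    apply: oppr_inj; rewrite -fl -mulrN -fk.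
    by rewrite -[in RHS]fc -rmorphM /= -lE.
  rewrite /e rmorphB rmorphM /= fc.
  transitivity (h - (h - frob h) - c * frob g); first by ring.
  by rewrite e1; ring.
have hE : h = c * g + e by rewrite /e; ring.
clearbody c e.
have e_eq0 : e = 0.
  have : tr_pair h u = c * tr_pair g u + e * tr4 u.
    rewrite !tr_pairE // tr4E hE !(rmorphD, rmorphM) /= !fc !fe; ring.
  by rewrite g_u tr_u mulr0 add0r mulr1 => <-; rewrite -h_v vE m1 mul1r.
exists c; split=> //.
  have := congr1 ( *%R l) mE; rewrite [RHS]mulrC divfK // => <-.
  by rewrite {1}lE; field; rewrite k_neq0.
by rewrite hE e_eq0 addr0.
Qed.

End Lines.

(** * Lifted Gabidulin planes and removed planes *)

Section Planes.

Variables (F : finFieldType) (L : fieldExtType F).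
Hypothesis dimL : \dim {:L} = 4%N.
Local Notation V := (V L).
Local Notation S := (S L).
Local Notation W := (W L).
Implicit Types g h u x z r rho : L.

Lemma mem_W_tr4 x : (x \in W) = (tr4 x == 0).
Proof. by rewrite memv_ker lfunE. Qed.

Lemma subvs_tr4 (x : subvs_of W) : tr4 (vsval x) = 0.
Proof. by apply/eqP; rewrite -mem_W_tr4 subvsP. Qed.

Definition base (v : V) : L := vsval v.1.

Fact base_is_linear : linear base.
Proof. by []. Qed.
HB.instance Definition _ :=
  GRing.isLinear.Build F V L *:%R base base_is_linear.

Lemma base_eq0 v : (base v == 0) = (v \in S).
Proof. by rewrite mem_S -[in LHS](linear0 (@vsval _ _ W)) (inj_eq subvs_inj). Qed.

Lemma lker_base : lker (linfun base) = S.
Proof. by apply/vspaceP=> v; rewrite memv_ker lfunE /= base_eq0. Qed.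

(* [x * frob z - frob x * z] is the Moore determinant of [x] and [z], which   *)
(* vanishes exactly when they are linearly dependent over F.                  *)
Lemma exists_wedge (U : {vspace L}) : (1 < \dim U)%N ->
  exists x z, [/\ x \in U, z \in U & x * frob z - frob x * z != 0].
Proof.
move=> dimU; set x := vpick U.
have x_neq0 : x != 0 by rewrite vpick0 -dimv_eq0 -lt0n ltnW.
have [z Uz zNx] : exists2 z, z \in U & z \notin <[x]>%VS.
  apply/subvPn; apply: contraTN dimU => /dimvS; rewrite dim_vline x_neq0.
  by rewrite -leqNgt.
exists x, z; split=> //; first exact: memv_pick.
apply: contra zNx; rewrite subr_eq0 => /eqP e.
have /frob_fixed[c cE] : frob (z / x) == z / x.
  by rewrite fmorph_div /= eqr_div ?frob_eq0 // mulrC e mulrC.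
by apply/vlineP; exists c; rewrite -[z](divfK x_neq0) cE mulr_algl.
Qed.

Lemma exists_wedgeV (U : {vspace V}) : ((\dim (U :&: S)).+1 < \dim U)%N ->
  exists v w, [/\ v \in U, w \in U &
    base v * frob (base w) - frob (base v) * base w != 0].
Proof.
move=> dimU; have := limg_ker_dim (linfun base) U; rewrite lker_base => dims.
have [|x [z [/memv_imgP[v Uv ->] /memv_imgP[w Uw ->]]]] :=
    @exists_wedge (linfun base @: U)%VS.
  by rewrite -(ltn_add2l (\dim (U :&: S))) dims addn1.
by rewrite !lfunE => ?; exists v, w.
Qed.

(** Cramer's rule. Hence every line disjoint from [S] lies on a lifted Gabidulin plane. *)
Lemma interpolate x z y t : x * frob z - frob x * z != 0 ->
  exists a0 a1, y = a0 * x + a1 * frob x /\ t = a0 * z + a1 * frob z.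
Proof.
move=> d; exists ((y * frob z - t * frob x) / (x * frob z - frob x * z)).
exists ((x * t - z * y) / (x * frob z - frob x * z)).
by split; field.
Qed.

Definition gab_fun a0 a1 (x : subvs_of W) : L := a0 * vsval x + a1 * frob (vsval x).

Fact gab_fun_is_linear a0 a1 : linear (gab_fun a0 a1).
Proof.
by move=> a x y; rewrite /gab_fun !linearP /= !mulrDr -!scalerAr addrACA scalerDr.
Qed.
HB.instance Definition _ a0 a1 := GRing.isLinear.Build F (subvs_of W) L *:%R
  (gab_fun a0 a1) (gab_fun_is_linear a0 a1).

Definition gab a0 a1 : 'Hom(subvs_of W, L) := linfun (gab_fun a0 a1).

Lemma gabE a0 a1 (x : subvs_of W) : gab a0 a1 x = a0 * vsval x + a1 * frob (vsval x).
Proof. by rewrite lfunE. Qed.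

Lemma gabidulinP f :
  reflect (exists a0 a1, f = gab a0 a1) (f \in gabidulin L).
Proof.
rewrite inE; apply: (iffP existsP) => [[a0 /existsP[a1 /forallP fE]]|].
  by exists a0, a1; apply/lfunP=> x; rewrite gabE; apply/eqP/fE.
case=> a0 [a1 ->]; exists a0; apply/existsP; exists a1; apply/forallP=> x.
by rewrite gabE.
Qed.

(** Outside [W] the trace of [u] is a nonzero element of F and can be moved into [r]. With
    [tr4 u = 1] the pair [(r, u)] is unique, which makes the removed maps countable by pairs. *)
Lemma removed_mapsP f :
  reflect (exists r u, [/\ r != 0, tr4 u = 1 & f = gab (- (r * frob u)) (r * u)])
          (f \in removed_maps L).
Proof.
rewrite inE; apply: (iffP existsP) => [[r /existsP[u]]|[r [u [r_neq0 tr_u ->]]]].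
  case/and3P=> r_neq0; rewrite mem_W_tr4 => tr_u /forallP fE.
  exists (r * tr4 (u : L)), ((u : L) / tr4 (u : L)).
  split; first by rewrite mulf_neq0.
    exact: tr4_normalize.
  apply/lfunP=> x; rewrite gabE (eqP (fE x)) /=.
  rewrite -[vsval x ^+ _]/(frob (vsval x)) -[(u : L) ^+ _]/(frob (u : L)).
  by rewrite fmorph_div /= frob_tr4 //; field.
exists r; apply/existsP; exists u; rewrite r_neq0 mem_W_tr4 tr_u oner_eq0 /=.
by apply/forallP=> x; rewrite gabE /frob; apply/eqP; ring.
Qed.

Lemma gab_eq_on_wedge a0 a1 b0 b1 x z : x * frob z - frob x * z != 0 ->
    a0 * x + a1 * frob x = b0 * x + b1 * frob x ->
    a0 * z + a1 * frob z = b0 * z + b1 * frob z ->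
  a0 = b0 /\ a1 = b1.
Proof.
move=> xz e1 e2.
have [||/eqP + /eqP] := cramer2_eq0 (a := a0 - b0) (b := a1 - b1) xz.
- by rewrite !mulrBl addrACA e1 -opprD subrr.
- by rewrite !mulrBl addrACA e2 -opprD subrr.
by rewrite !subr_eq0 => /eqP-> /eqP->.
Qed.

Lemma gab_inj a0 a1 b0 b1 : gab a0 a1 = gab b0 b1 -> a0 = b0 /\ a1 = b1.
Proof.
move=> e; have [|x [z [Wx Wz xz]]] := @exists_wedge W; first by rewrite dim_W.
have eqW y : y \in W -> a0 * y + a1 * frob y = b0 * y + b1 * frob y.
  by move=> Wy; have /lfunP/(_ (Subvs Wy)) := e; rewrite !gabE.
by apply: gab_eq_on_wedge xz _ _; apply: eqW.
Qed.

Lemma dim_Gamma (f : 'Hom(subvs_of W, L)) : \dim (Gamma f) = 3%N.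
Proof.
rewrite limg_dim_eq; first by rewrite dimvf /dim /= -/(\dim W) dim_W.
apply/eqP; rewrite capfv -subv0; apply/subvP=> x.
by rewrite memv_ker lfunE /= memv0 => /eqP[->].
Qed.

Lemma Gamma_capS (f : 'Hom(subvs_of W, L)) : (Gamma f :&: S)%VS = 0%VS.
Proof.
apply/eqP; rewrite -subv0; apply/subvP=> -[x y].
rewrite memv_cap mem_Gamma mem_S memv0 /= => /andP[/eqP-> /eqP->].
by rewrite linear0.
Qed.

Lemma Gamma_inj : injective (@Gamma F L).
Proof.
move=> f g e; apply/lfunP=> x; apply/eqP.
by have := mem_Gamma g (x, f x); rewrite -e mem_Gamma eqxx /= => <-.
Qed.

Lemma gab_code a0 a1 b0 b1 :
  gab a0 a1 != gab b0 b1 -> (\dim (Gamma (gab a0 a1) :&: Gamma (gab b0 b1)) <= 1)%N.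
Proof.
apply: contraNT; rewrite -ltnNge => dimI.
have [|v [w [/memv_capP[va vb] /memv_capP[wa wb] vw]]] :=
    @exists_wedgeV (Gamma (gab a0 a1) :&: Gamma (gab b0 b1)).
  by rewrite -capvA Gamma_capS capv0 dimv0.
move: va vb wa wb; rewrite !mem_Gamma !gabE => /eqP-> /eqP e1 /eqP-> /eqP e2.
by have [-> ->] := gab_eq_on_wedge vw e1 e2.
Qed.

End Planes.

(** * The new planes: dimensions and intersections *)

Section NewPlanes.

Variables (F : finFieldType) (L : fieldExtType F).
Hypothesis dimL : \dim {:L} = 4%N.
Local Notation V := (V L).
Local Notation S := (S L).
Local Notation W := (W L).
Implicit Types g h x y z r rho sig : L.

Let frobK := frob4 dimL.

Fact tr_pair_is_linear g : linear (tr_pair g).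
Proof. by move=> a x y; rewrite /tr_pair !linearP /= mulrDr -scalerAr linearP. Qed.
HB.instance Definition _ g :=
  GRing.isLinear.Build F L L *:%R (tr_pair g) (tr_pair_is_linear g).

Definition new_eqn rho g (v : V) : L * L :=
  (tr_pair g (base v), v.2 / rho + frob (v.2 / rho) - gam g * frob (base v)).

Fact new_eqn_is_linear rho g : linear (new_eqn rho g).
Proof.
move=> a v w; congr (_, _) => /=; first by rewrite linearP.
rewrite [base _]linearP [frob (a *: base v + _)]linearP /=.
rewrite mulrDl -scalerAl linearP /= mulrDr -scalerAr.
by rewrite addrACA -scalerDr opprD addrACA -scalerBr.
Qed.
HB.instance Definition _ rho g := GRing.isLinear.Build F V (L * L)%type *:%R
  (new_eqn rho g) (new_eqn_is_linear rho g).

Definition new_plane rho g : {vspace V} := lker (linfun (new_eqn rho g)).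

Lemma mem_new_plane rho g v :
  (v \in new_plane rho g) = in_new rho g (base v) v.2.
Proof.
by rewrite memv_ker lfunE /= /new_eqn xpair_eqE /in_new subvs_tr4 eqxx subr_eq0.
Qed.

(** Scaling [g] by [c] divides [gam g] by [c], just as scaling [rho] divides [w / rho]. *)
Lemma new_plane_scale c rho g : frob c = c -> c != 0 ->
  new_plane (c * rho) (c * g) = new_plane rho g.
Proof.
move=> fc c_neq0; apply/vspaceP=> v; rewrite !mem_new_plane /in_new.
have -> : tr_pair (c * g) (base v) = c * tr_pair g (base v).
  by rewrite !tr_pairE // !rmorphM /= !fc; ring.
have fci : frob c^-1 = c^-1 by rewrite fmorphV /= fc.
have -> : v.2 / (c * rho) = c^-1 * (v.2 / rho) by rewrite invfM; ring.
rewrite gam_scale // rmorphM /= fci -mulrDr [gam g / c]mulrC -mulrA.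
by rewrite mulf_eq0 (negPf c_neq0) (inj_eq (mulfI _)) // invr_eq0.
Qed.

Lemma sigma_new_plane r rho g :
  r != 0 -> (sigma r @: new_plane rho g)%VS = new_plane (r * rho) g.
Proof.
move=> r_neq0; have rK y : r * y / (r * rho) = y / rho.
  by rewrite -mulf_div divff // mul1r.
apply/vspaceP=> v; apply/memv_imgP/idP=> [[w + ->]|].
  by rewrite lfunE /= /sigma_fun !mem_new_plane /base /= /in_new rK.
rewrite mem_new_plane => v_in; exists (v.1, v.2 / r).
  by rewrite mem_new_plane /base /= /in_new -rK [r * _]mulrC divfK.
by rewrite lfunE /= /sigma_fun /= mulrC divfK //; case: (v).
Qed.

Lemma capS_new_plane rho g : rho != 0 ->
  (new_plane rho g :&: S)%VS =
    (linfun (@inS F L) @: (amull rho @: lker (frobD1 L)))%VS.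
Proof.
move=> rho_neq0; apply/vspaceP=> v; rewrite memv_cap mem_S mem_new_plane /in_new.
apply/idP/memv_imgP=> [/andP[/and3P[_ _ +] /eqP v1]|].
  rewrite /base v1 !linear0 mulr0 => e; exists v.2.
    apply/memv_imgP; exists (v.2 / rho); first by rewrite memv_ker frobD1E.
    by rewrite lfunE /= mulrC divfK.
  by rewrite lfunE /= /inS -v1; case: (v).
case=> _ /memv_imgP[y + ->] ->; rewrite memv_ker frobD1E !lfunE /= => y_ker.
by rewrite /base !linear0 mulr0 [rho * y]mulrC mulfK // y_ker !eqxx.
Qed.

Lemma dim_capS_new_plane rho g : rho != 0 -> \dim (new_plane rho g :&: S) = 1%N.
Proof.
move=> rho_neq0; rewrite capS_new_plane // !limg_dim_eq ?dim_ker_frobD1 //.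
  apply/eqP; rewrite -subv0; apply/subvP=> x.
  rewrite memv_cap memv_ker lfunE /= mulf_eq0 (negPf rho_neq0) memv0.
  by case/andP.
apply/eqP; rewrite -subv0; apply/subvP=> x.
by rewrite memv_cap memv_ker lfunE /= memv0 => /andP[_ /eqP[->]].
Qed.

(** By [gam_decomp] the value is [c * tr_pair g x + d * tr4 x]. Through [limg_frobD1] this makes
    [y + y_1 = gam g * x_1] solvable for every admissible [x]. *)
Lemma alt4_gam g x : frob g != g -> tr4 x = 0 -> tr_pair g x = 0 ->
  alt4 (gam g * frob x) = 0.
Proof.
move=> g_nF tr_x gx; have [c [d [fc fd ->]]] := gam_decomp dimL g_nF.
transitivity (c * tr_pair g x + d * tr4 x).
  rewrite tr_pairE // tr4E /alt4 !(rmorphM, rmorphD, rmorphN) /=.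
  by do 3!rewrite ?(fc, fd, rmorphN, opprK) /=; rewrite !frobK; ring.
by rewrite tr_x gx !mulr0 addr0.
Qed.

(** At most 2 by the q-polynomial of [tr_pair_qpoly]; at least 2 because [tr_pair g] maps the
    three-dimensional [W] into F. *)
Lemma dim_tr_pair g : frob g != g ->
  \dim (W :&: lker (linfun (tr_pair g))) = 2%N.
Proof.
move=> g_nF; apply/eqP; rewrite eqn_leq; apply/andP; split.
  apply: (@dim_qpoly_le _ _ _ [:: g - frob g; g - frob (frob g);
                              g - frob (frob (frob g))]) => [|x].
    by rewrite /= subr_eq0 eq_sym g_nF.
  rewrite memv_cap mem_W_tr4 memv_ker lfunE /= => /andP[/eqP tr_x /eqP gx].
  rewrite !big_ord_recl big_ord0 /= addr0.
  transitivity (g * tr4 x - tr_pair g x).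
    by rewrite -tr_pair_qpoly //; ring.
  by rewrite tr_x gx mulr0 subrr.
have := limg_ker_dim (linfun (tr_pair g)) W; rewrite dim_W // => dims.
have : (\dim (linfun (tr_pair g) @: W) <= 1)%N.
  apply: leq_trans (eq_leq (dimv1 L)); apply/dimvS/subvP=> _ /memv_imgP[x _ ->].
  by rewrite lfunE /=; apply/vlineP/frob_fixed; rewrite /tr_pair frob_tr4.
by move=> img_le; rewrite -ltnS /leq -[3%N]dims -addn1 subnDl.
Qed.

Lemma dim_new_plane rho g :
  rho != 0 -> frob g != g -> \dim (new_plane rho g) = 3%N.
Proof.
move=> rho_neq0 g_nF; rewrite -(limg_ker_dim (linfun (@base F L))) lker_base.
rewrite dim_capS_new_plane // -(dim_tr_pair g_nF); congr (1 + \dim _)%N.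
apply/vspaceP=> x; apply/memv_imgP/idP=> [[v + ->]|].
  rewrite mem_new_plane lfunE /= => /and3P[tr_v gv _].
  by rewrite memv_cap mem_W_tr4 tr_v memv_ker lfunE.
rewrite memv_cap memv_ker lfunE /= => /andP[Wx /eqP gx].
have tr_x : tr4 x = 0 by apply/eqP; rewrite -mem_W_tr4.
have : gam g * frob x \in lker (linfun (@alt4 F L)).
  by rewrite memv_ker lfunE /= alt4_gam.
rewrite -limg_frobD1 // => /memv_imgP[y _ yE].
exists (Subvs Wx, rho * y); last by rewrite lfunE.
rewrite mem_new_plane /in_new /base /= tr_x gx !eqxx /=.
by rewrite [rho * y]mulrC mulfK // yE frobD1E.
Qed.

Lemma new_gab_code rho g a0 a1 : rho != 0 -> frob g != g ->
  gab a0 a1 \notin removed_maps L ->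
  (\dim (new_plane rho g :&: Gamma (gab a0 a1)) <= 1)%N.
Proof.
move=> rho_neq0 g_nF; apply: contraNT; rewrite -ltnNge => dimI.
have [|v [w [/memv_capP[vE vG] /memv_capP[wE wG] vw]]] :=
    @exists_wedgeV _ _ (new_plane rho g :&: Gamma (gab a0 a1)).
  by rewrite -capvA Gamma_capS capv0 dimv0.
move: vE wE vG wG; rewrite !mem_new_plane !mem_Gamma !gabE => vE wE /eqP v2 /eqP w2.
rewrite v2 in vE; rewrite w2 in wE.
have [u [tr_u _ -> ->]] := new_line_removed dimL rho_neq0 g_nF vw vE wE.
apply/removed_mapsP => //; exists (rho / (g - frob (frob (frob g)))), u.
have [_ _ _ d3] := frob_fix_trans dimL g_nF.
by split=> //; rewrite mulf_neq0 // invr_eq0 -opprB oppr_eq0.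
Qed.

Lemma new_planes_meet rho g sig h :
    rho != 0 -> sig != 0 -> frob g != g -> frob h != h ->
    ((\dim (new_plane rho g :&: new_plane sig h :&: S)).+1 <
       \dim (new_plane rho g :&: new_plane sig h))%N ->
  exists c, [/\ c != 0, frob c = c, sig = c * rho & h = c * g].
Proof.
move=> rho_neq0 sig_neq0 g_nF h_nF dimI.
have [v [w [/memv_capP[vg vh] /memv_capP[wg wh] vw]]] := exists_wedgeV dimI.
have [a0 [a1 [v2 w2]]] := interpolate v.2 w.2 vw.
move: vg vh wg wh; rewrite !mem_new_plane v2 w2 => vg vh wg wh.
exact: new_line_unique vw vg wg vh wh.
Qed.

Lemma new_plane_eq rho g sig h :
    rho != 0 -> sig != 0 -> frob g != g -> frob h != h ->
  new_plane rho g = new_plane sig h ->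
  exists c, [/\ c != 0, frob c = c, sig = c * rho & h = c * g].
Proof.
move=> rho_neq0 sig_neq0 g_nF h_nF e; apply: new_planes_meet => //.
by rewrite -e capvv dim_new_plane // dim_capS_new_plane.
Qed.

(** Since [y / rho] changes sign under [frob], the quotient [frob rho / rho] depends on [y] alone,
    and it determines [rho] up to F. *)
Lemma new_plane_point rho g sig h y : y != 0 ->
    rho != 0 -> sig != 0 ->
    inS y \in new_plane rho g -> inS y \in new_plane sig h ->
  exists c, [/\ c != 0, frob c = c & sig = c * rho].
Proof.
move=> y_neq0 rho_neq0 sig_neq0.
rewrite !mem_new_plane /in_new /base /= !linear0 !mulr0.
case/and3P=> _ _ yg /and3P[_ _ yh].
exists (sig / rho); split; last by rewrite divfK.
  by rewrite mulf_neq0 ?invr_eq0.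
have skew_neg z : z != 0 -> y / z + frob (y / z) == 0 -> frob z / z = - (frob y / y).
  move=> z_neq0; rewrite fmorph_div /= addr_eq0 => /eqP e.
  have fz : frob z != 0 by rewrite frob_eq0.
  apply/eqP; rewrite -subr_eq0 opprK addrC; apply/eqP.
  transitivity (frob z / y * (y / z + frob y / frob z)).
    by field; rewrite fz y_neq0 z_neq0.
  by rewrite e addNr mulr0.
have : frob sig / sig = frob rho / rho by rewrite (skew_neg sig) // (skew_neg rho).
rewrite fmorph_div /= => e; apply/eqP; rewrite eqr_div ?frob_eq0 //.
move/eqP: e; rewrite eqr_div // => /eqP e; apply/eqP.
by rewrite e mulrC.
Qed.

End NewPlanes.

(** * Counting admissible [g]; new planes form a code *)

Section Counting.

Variables (F : finFieldType) (L : fieldExtType F).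
Hypothesis dimL : \dim {:L} = 4%N.
Local Notation q := #|F|.
Local Notation finL := (finvect_type L).
(* Bound variables of the finite sets below have type [finL]; these notations *)
(* keep the operations in the structure [L], so that lemmas can be rewritten. *)
Local Notation frob := (@frob F L).
Local Notation tr4 := (@tr4 F L).
Local Notation gam := (@gam F L).
Local Notation skew_disc := (@skew_disc F L).
Implicit Types g h u v x y z r rho sig t : L.

Let frobK := frob4 dimL.
Let q_gt1 : (1 < q)%N := finNzRing_gt1 F.

Lemma card_unity_roots n : (0 < n)%N -> (n %| (q ^ 4).-1)%N ->
  #|[set x : finL | (x : L) ^+ n == 1]| = n.
Proof.
move=> n_gt0 n_dvd; set N := (q ^ 4).-1 in n_dvd.
have NS : (q ^ 4 = N.+1)%N by rewrite prednK // expn_gt0 ltnW.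
have N_gt0 : (0 < N)%N by rewrite -ltnS -NS -(exp1n 4) ltn_exp2r.
pose rs : seq L := enum [pred x : finL | x != 0].
have rsE x : (x \in rs) = (x != 0) by rewrite (mem_enum (T := finL)).
have unity x : x != 0 -> x ^+ N = 1.
  move=> x_neq0; apply: (mulfI x_neq0); rewrite mulr1 -exprS -NS.
  by rewrite -iter_frob /= frobK.
have /hasP[z _ z_prim] : has N.-primitive_root rs.
  apply: has_prim_root => //.
  - by apply/allP=> x; rewrite rsE unity_rootE => /unity->.
  - exact: (enum_uniq (T := finL)).
  - by rewrite -(cardE (T := finL)) cardC1 (card_L dimL).
have w_prim := dvdn_prim_root z_prim n_dvd; set w := z ^+ _ in w_prim.
rewrite -[RHS]card_ord -(card_imset _ (f := fun i : 'I_n => w ^+ i : finL)).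
  apply: eq_card => x; rewrite inE; apply/eqP/imsetP.
    by case/(prim_rootP w_prim)=> i ->; exists i.
  by case=> i _ ->; rewrite exprAC (prim_expr_order w_prim) expr1n.
move=> i j /= /eqP; rewrite (eq_prim_root_expr w_prim) !modn_small //.
by move/eqP/val_inj.
Qed.

Lemma skew_discE g :
  skew_disc g = g ^+ (1 + q ^ 2) * (1 - g ^+ ((q ^ 2 + 1) * (q - 1))).
Proof.
have f3 : frob (frob (frob g)) = g ^+ (q ^ 3) by rewrite -iter_frob.
have f2 : frob (frob g) = g ^+ (q ^ 2) by rewrite -iter_frob.
rewrite /skew_disc f3 f2 /frob mulrBr mulr1 -!exprD -exprS.
congr (_ - _ ^+ _); rewrite mulnBr muln1 [(q ^ 2 + 1)%N]addnC.
by rewrite subnKC ?leq_pmulr 1?ltnW // mulnDl mul1n -expnSr.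
Qed.

(** Besides 0 these are the roots of unity of order dividing [(q ^ 2 + 1) * (q - 1)], which divides
    [q ^ 4 - 1] with cofactor [q + 1]. *)
Lemma card_skew_disc0 :
  #|[set g : finL | skew_disc g == 0]| = (q ^ 3 - q ^ 2 + q)%N.
Proof.
have n_gt0 : (0 < (q ^ 2 + 1) * (q - 1))%N by rewrite muln_gt0 addn1 subn_gt0.
have -> : [set g : finL | skew_disc g == 0] =
    (0 : finL) |: [set x : finL | (x : L) ^+ ((q ^ 2 + 1) * (q - 1)) == 1].
  apply/setP=> g; rewrite !inE skew_discE mulf_eq0 expf_eq0 addn_gt0 /=.
  by rewrite subr_eq0 eq_sym [1 == _]eq_sym.
rewrite cardsU1 inE expr0n gtn_eqF // eq_sym oner_eq0 card_unity_roots //.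
  by have := q_gt1; rewrite mulnBr muln1 mulnDl mul1n -expnSr; nia.
apply/dvdnP; exists q.+1; case: #|F| q_gt1 => // m _; rewrite subn1 /=.
by rewrite !expnS expn0 muln1; lia.
Qed.

Lemma card_frob_fixed : #|[set g : finL | frob g == g]| = q.
Proof.
rewrite -(card_imset _ (f := fun a : F => a%:A : finL)).
  apply: eq_card => g; rewrite inE; apply/frob_fixed/imsetP; case=> a.
    by move->; exists a.
  by move=> _ ->; exists a.
by move=> a b /(fmorph_inj (in_alg L)).
Qed.

Lemma exists_skew_disc0 : exists t, frob t != t /\ skew_disc t = 0.
Proof.
have /subsetPn[t] : ~~ ([set g : finL | skew_disc g == 0] \subset
                          [set g : finL | frob g == g]).
  apply: contraTN q_gt1 => /subset_leq_card.
  by rewrite card_skew_disc0 card_frob_fixed; nia.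
by rewrite !inE => /eqP ? ?; exists t.
Qed.

(* [gam g] lies outside the kernel of [y + frob y] in the first case and in   *)
(* it in the second, where only the F-multiples of [t] are kept.              *)
Definition good t g :=
  (frob g != g) && ((skew_disc g != 0) || (frob (g / t) == g / t)).

Lemma card_scalars (T : finType) (f : F -> T) : injective f ->
  #|[set f c | c in [set~ 0]]| = (q - 1)%N.
Proof. by move=> f_inj; rewrite card_imset // cardsC1 subn1. Qed.

(** The count is [q ^ 4 - (q ^ 3 - q ^ 2 + q) + (q - 1)]: elements with nonzero [skew_disc], which
    are automatically outside F, and the nonzero F-multiples of [t]. *)
Lemma card_good t : frob t != t -> skew_disc t = 0 ->
  #|[set g : finL | good t g]| = ((q - 1) * (q ^ 3 + q + 1))%N.
Proof.
move=> t_nF t0; have t_neq0 : t != 0.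
  by apply: contraNneq t_nF => ->; rewrite rmorph0.
have scale_inj : injective (fun c : F => c%:A * t : finL).
  by move=> a b /(mulIf t_neq0)/(fmorph_inj (in_alg L)).
have -> : [set g : finL | good t g] = ~: [set g : finL | skew_disc g == 0]
    :|: [set (c%:A * t : finL) | c in [set~ (0 : F)]].
  apply/setP=> g; rewrite !inE; apply/andP/orP=> [[g_nF /orP[|/frob_fixed[c]]]|].
  - by left.
  - move=> gt; have gE : g = c%:A * t by rewrite -gt divfK.
    right; apply/imsetP; exists c; rewrite // !inE.
    by apply: contraNneq g_nF => c0; rewrite gE c0 scale0r mul0r rmorph0.
  - case=> [g0 | /imsetP[c]].
      split; last by rewrite g0.
      apply: contraNneq g0 => fg.
      by rewrite /skew_disc !fg subrr.
    rewrite !inE => c_neq0 ->; rewrite mulfK // frob_scalar eqxx orbT.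
    rewrite rmorphM /= frob_scalar (inj_eq (mulfI _)) //.
    by rewrite scaler_eq0 oner_eq0 orbF.
rewrite cardsU disjoint_setI0 ?cards0 ?subn0; last first.
  rewrite disjoint_sym disjoints_subset setCK; apply/subsetP=> _ /imsetP[c _ ->].
  rewrite inE /skew_disc !rmorphM /= !frob_scalar; apply/eqP.
  by rewrite -[RHS](mulr0 (c%:A * c%:A)) -t0 /skew_disc; ring.
rewrite card_scalars // cardsCs setCK card_skew_disc0 card_L //.
by have := q_gt1; case: #|F| => // m; rewrite !expnS expn0; nia.
Qed.

Lemma exists_tr1 : exists u : L, tr4 u = 1.
Proof.
have /subvPn[x _] : ~~ ({:L} <= W L)%VS.
  by apply/negP=> /dimvS; rewrite dimL dim_W.
rewrite mem_W_tr4 => x_neq0; exists (x / tr4 x); exact: tr4_normalize.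
Qed.

Lemma card_tr1 : #|[set u : finL | tr4 u == 1]| = (q ^ 3)%N.
Proof.
have [u0 tr_u0] := exists_tr1.
have trD x y : tr4 (x + y) = tr4 x + tr4 y by apply: linearD.
rewrite -(dim_W dimL) -card_vspaceE -[RHS]cardsE.
rewrite -[RHS](card_imset _ (addrI (u0 : finL))); apply: eq_card => u; rewrite inE.
apply/eqP/imsetP=> [tr_u|[w]]; last first.
  by rewrite inE (@mem_W_tr4 F L) => /eqP tr_w ->; rewrite trD tr_u0 tr_w addr0.
exists (u - u0); last by rewrite addrC subrK.
rewrite inE (@mem_W_tr4 F L) -(inj_eq (addIr (tr4 u0))) -trD subrK tr_u tr_u0.
by rewrite add0r.
Qed.

Lemma good_scale t c g : frob c = c -> c != 0 -> good t (c * g) = good t g.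
Proof.
move=> fc c_neq0; rewrite /good rmorphM /= fc (inj_eq (mulfI c_neq0)).
rewrite -mulrA rmorphM /= fc (inj_eq (mulfI c_neq0)); congr (_ && (_ || _)).
have -> : skew_disc (c * g) = c * c * skew_disc g.
  by rewrite /skew_disc !rmorphM /= !fc; ring.
by rewrite !mulf_eq0 (negPf c_neq0).
Qed.

(** [gam_inj_generic] asks for a nonzero [skew_disc] on one side only, which covers the mixed case;
    on multiples of [t], [gam (c * t) = gam t / c]. *)
Lemma gam_inj_good t g h : frob t != t ->
  good t g -> good t h -> gam g = gam h -> g = h.
Proof.
move=> t_nF /andP[g_nF good_g] /andP[h_nF good_h] eq_gam.
have t_neq0 : t != 0 by apply: contraNneq t_nF => ->; rewrite rmorph0.
case/orP: good_g => [g0|/eqP g_t]; first exact: (gam_inj_generic dimL).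
case/orP: good_h => [h0|/eqP h_t]; first by apply/esym/(gam_inj_generic dimL).
have gE : g = g / t * t by rewrite divfK.
have hE : h = h / t * t by rewrite divfK.
have c_neq0 k : frob k != k -> k / t != 0.
  by apply: contraNneq => /(canRL (divfK t_neq0)) ->; rewrite mul0r rmorph0.
move: eq_gam; rewrite gE hE !gam_scale ?c_neq0 //.
by move/(mulfI (gam_neq0 dimL t_nF))/invr_inj ->.
Qed.

(** A common line disjoint from [S] falls under [new_planes_meet]. Otherwise a common point of [S]
    allows the same [rho] for both planes, and a common vector outside [S] equates the values of
    [gam]. *)
Lemma new_code t rho g sig h : frob t != t ->
    rho != 0 -> sig != 0 -> good t g -> good t h ->
    new_plane rho g != new_plane sig h ->
  (\dim (new_plane rho g :&: new_plane sig h) <= 1)%N.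
Proof.
move=> t_nF rho_neq0 sig_neq0 good_g good_h; apply: contraNT; rewrite -ltnNge.
have g_nF : frob g != g by case/andP: good_g.
have h_nF : frob h != h by case/andP: good_h.
set I := (_ :&: _)%VS => dimI; have [IS0|IS_neq0] := eqVneq (I :&: S L)%VS 0%VS.
  have [|c [c_neq0 fc -> ->]] := new_planes_meet dimL rho_neq0 sig_neq0 g_nF h_nF.
    by rewrite -/I IS0 dimv0.
  by rewrite new_plane_scale.
have [y [y_neq0 yI]] : exists y : L, y != 0 /\ inS y \in I.
  have := memv_pick (I :&: S L); have := IS_neq0; rewrite -vpick0.
  move: (vpick _) => [v y] v_neq0; rewrite memv_cap mem_S /= => /andP[vI /eqP v0].
  exists y; rewrite /inS -v0; split=> //.
  by apply: contraNneq v_neq0 => y0; rewrite v0 y0.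
have [yg yh] := memv_capP yI.
have [c [c_neq0 fc sigE]] := new_plane_point y_neq0 rho_neq0 sig_neq0 yg yh.
have fci : frob c^-1 = c^-1 by rewrite fmorphV /= fc.
have hE : new_plane sig h = new_plane rho (c^-1 * h).
  by rewrite -[RHS](new_plane_scale dimL _ _ fc c_neq0) mulVKf // -sigE.
have [v vI vS] : exists2 v, v \in I & v \notin S L.
  apply/subvPn; apply: contraTN dimI => IS; rewrite -leqNgt.
  rewrite -(dim_capS_new_plane dimL g rho_neq0); apply: dimvS.
  by rewrite subv_cap IS andbT capvSl.
rewrite -base_eq0 in vS; have fv : frob (base v) != 0 by rewrite frob_eq0.
move: vI; rewrite /I hE => /memv_capP[]; rewrite !mem_new_plane.
case/and3P=> _ _ /eqP e /and3P[_ _]; rewrite {}e => /eqP/(mulIf fv) eq_gam.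
by rewrite -(gam_inj_good t_nF good_g _ eq_gam) // good_scale ?invr_eq0.
Qed.

End Counting.

Lemma card_imset_fibers (aT rT : finType) (f : aT -> rT) (A : {set aT}) m :
  {in A, forall x, #|[set y in A | f y == f x]| = m} ->
  (#|A| = #|f @: A| * m)%N.
Proof.
move=> fib; rewrite -sum1_card (partition_big_imset f) /= -sum_nat_const.
apply: eq_bigr => _ /imsetP[x Ax ->]; rewrite -(fib x Ax) -sum1_card.
by apply: eq_bigl => y; rewrite inE.
Qed.

(** * Size of [L0] and the action of [Sigma] *)

Section Code.

Variables (F : finFieldType) (L : fieldExtType F).
Hypothesis dimL : \dim {:L} = 4%N.
Local Notation q := #|F|.
Local Notation finL := (finvect_type L).
Local Notation frob := (@frob F L).
Local Notation tr4 := (@tr4 F L).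
Local Notation V := (V L).
Local Notation S := (S L).
Local Notation L0 := (L0 L).
Implicit Types g h u v x y z r rho sig t : L.

Let q_gt1 : (1 < q)%N := finNzRing_gt1 F.

Lemma L0P (E : {vspace V}) :
  reflect (exists a0 a1, E = Gamma (gab a0 a1) /\ gab a0 a1 \notin removed_maps L)
          (E \in L0).
Proof.
rewrite inE; apply: (iffP andP) => [[nr /imsetP[_ /gabidulinP[a0 [a1 ->]] EE]]|].
  by exists a0, a1; split=> //; apply: contra nr; rewrite EE; apply: imset_f.
case=> a0 [a1 [-> nr]]; split; last first.
  by apply/imset_f/gabidulinP; exists a0, a1.
by rewrite mem_imset //; apply: Gamma_inj.
Qed.

Lemma card_gabidulin : #|gabidulin L| = (q ^ 8)%N.
Proof.
have -> : gabidulin L = (fun p : finL * finL => gab (p.1 : L) (p.2 : L)) @: setT.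
  apply/setP=> f; apply/gabidulinP/imsetP=> [[a0 [a1 ->]]|[p _ ->]].
    by exists (a0, a1); rewrite ?inE.
  by exists p.1, p.2.
rewrite card_imset ?cardsT ?card_prod ?(card_L dimL) -?expnD //.
by move=> [a0 a1] [b0 b1] /(gab_inj dimL)[/= -> ->].
Qed.

Lemma card_nonzero : #|[set r : finL | r != 0]| = (q ^ 4 - 1)%N.
Proof.
rewrite -(card_L dimL) -cardsT -(cards1 (0 : finL)) -cardsDS ?subsetT //.
by apply: eq_card => x; rewrite !inE andbT.
Qed.

(** If [(r, u)] and [(s, v)] give the same map, [u / v] is fixed by [frob], and the traces 1 force
    [u = v]. *)
Lemma card_removed_maps : #|removed_maps L| = ((q ^ 4 - 1) * q ^ 3)%N.
Proof.
pose R := setX [set r : finL | r != 0] [set u : finL | tr4 u == 1].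
have -> : removed_maps L =
    (fun p : finL * finL => gab (- ((p.1 : L) * frob p.2)) ((p.1 : L) * p.2))
      @: R.
  apply/setP=> f; apply/(removed_mapsP dimL)/imsetP.
    case=> r [u [r_neq0 tr_u ->]]; exists (r, u) => //.
    by rewrite !inE r_neq0 tr_u eqxx.
  case=> -[r u]; rewrite !inE /= => /andP[r_neq0 /eqP tr_u] ->.
  by exists r, u.
rewrite card_in_imset ?cardsX ?card_tr1 ?card_nonzero //.
move=> [r u] [s v]; rewrite !inE /= => /andP[r0 /eqP tr_u] /andP[s0 /eqP tr_v].
case/(gab_inj dimL) => /oppr_inj e1 e2.
have v_neq0 : v != 0.
  by apply: contraPneq tr_v => ->; rewrite linear0 => /esym/eqP; rewrite oner_eq0.
have rE : r * (u / v) = s by rewrite mulrA e2 mulfK.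
have /frob_fixed[c cE] : frob (u / v) == u / v.
  rewrite fmorph_div /= eqr_div ?frob_eq0 //; apply/eqP/(mulfI r0).
  by rewrite mulrA e1 [RHS]mulrA e2 mulrAC.
have uE : u = c%:A * v by rewrite -cE divfK.
have c1 : c%:A = 1 :> L.
  move: tr_u; rewrite uE tr4E !rmorphM /= !frob_scalar -!mulrDr -tr4E tr_v.
  by rewrite mulr1.
by congr (_, _); [rewrite -rE cE c1 mulr1 | rewrite uE c1 mul1r].
Qed.

Lemma removed_maps_sub : removed_maps L \subset gabidulin L.
Proof.
apply/subsetP=> f /(removed_mapsP dimL)[r [u [_ _ ->]]].
by apply/gabidulinP; exists (- (r * frob u)), (r * u).
Qed.

Lemma card_L0 : #|L0| = (q ^ 8 - q ^ 7 + q ^ 3)%N.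
Proof.
rewrite cardsDS; last exact/imsetS/removed_maps_sub.
rewrite !card_imset; try exact: Gamma_inj.
by rewrite card_gabidulin card_removed_maps mulnBl mul1n -expnD subnA ?leq_exp2l //.
Qed.

Lemma sigmaE r (v : V) : sigma r v = (v.1, r * v.2).
Proof. by rewrite lfunE. Qed.

Lemma sigma_Gamma r a0 a1 : r != 0 ->
  (sigma r @: Gamma (gab a0 a1))%VS = Gamma (gab (r * a0) (r * a1)).
Proof.
move=> r_neq0; apply/vspaceP=> v; rewrite mem_Gamma gabE -!mulrA -mulrDr.
apply/memv_imgP/eqP=> [[w + ->]|v2].
  by rewrite mem_Gamma gabE sigmaE /= => /eqP->.
exists (v.1, r^-1 * v.2); first by rewrite mem_Gamma gabE /= v2 mulKf.
by rewrite sigmaE /= mulVKf //; case: (v).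
Qed.

Lemma Sigma_invariant_stable (C : {set {vspace V}}) :
  (forall r E, r != 0 -> E \in C -> (sigma r @: E)%VS \in C) ->
  Sigma_invariant C.
Proof.
move=> stable r r_neq0; apply/setP=> E; apply/imsetP/idP=> [[D DC ->]|EC].
  exact: stable.
exists (sigma r^-1 @: E)%VS; first by apply: stable; rewrite ?invr_eq0.
rewrite -limg_comp; apply/esym/vspaceP=> v; apply/memv_imgP/idP=> [[w wE ->]|vE].
  by rewrite comp_lfunE !sigmaE /= mulVKf //; case: (w) wE.
by exists v => //; rewrite comp_lfunE !sigmaE /= mulVKf //; case: (v).
Qed.

Lemma sigma_L0 r E : r != 0 -> E \in L0 -> (sigma r @: E)%VS \in L0.
Proof.
move=> r_neq0 /L0P[a0 [a1 [-> nr]]]; apply/L0P; exists (r * a0), (r * a1).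
split; first exact: sigma_Gamma.
apply: contra nr => /(removed_mapsP dimL)[s [u [s_neq0 tr_u]]].
case/(gab_inj dimL) => e0 e1; apply/(removed_mapsP dimL); exists (r^-1 * s), u.
split; rewrite ?mulf_neq0 ?invr_eq0 //.
by rewrite -!mulrA -mulrN -e0 -e1 !mulKf.
Qed.

(** * The augmented code *)

Section New.

Variable t : L.
Hypothesis t_nF : frob t != t.
Hypothesis t0 : skew_disc t = 0.

Definition new_params : {set finL * finL} :=
  setX [set r : finL | r != 0] [set g : finL | good t g].

Definition new_planes : {set {vspace V}} :=
  (fun p : finL * finL => new_plane (p.1 : L) (p.2 : L)) @: new_params.

Lemma new_planesP E :
  reflect (exists rho g, [/\ rho != 0, good t g & E = new_plane rho g])
          (E \in new_planes).
Proof.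
apply: (iffP imsetP) => [[[r g] + ->]|[r [g [r0 g_good ->]]]].
  by rewrite !inE /= => /andP[]; exists r, g.
by exists (r, g); rewrite // !inE /= r0.
Qed.

Lemma good_nF g : good t g -> frob g != g.
Proof. by case/andP. Qed.

(** Each plane comes from [q - 1] pairs, an orbit of the nonzero scalars of F. *)
Lemma card_new_planes : #|new_planes| = ((q ^ 4 - 1) * (q ^ 3 + q + 1))%N.
Proof.
have : #|new_params| = (#|new_planes| * (q - 1))%N.
  apply: card_imset_fibers => -[r g]; rewrite !inE /= => /andP[r_neq0 g_good].
  rewrite -(@card_scalars F (finL * finL)%type (fun c => (c%:A * r, c%:A * g))).
    apply: eq_card => -[s h]; rewrite !inE /=; apply/andP/imsetP.
      case=> /andP[s_neq0 h_good] /eqP/esym/(new_plane_eq dimL).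
      case/(_ r_neq0 s_neq0 (good_nF g_good) (good_nF h_good)) => c [c_neq0 /eqP].
      case/frob_fixed=> a cE -> ->; exists a; rewrite ?cE // !inE.
      by apply: contraNneq c_neq0 => a0; rewrite cE a0 scale0r.
    case=> a; rewrite !inE => a_neq0 [-> ->].
    have aA_neq0 : a%:A != 0 :> L by rewrite scaler_eq0 negb_or a_neq0 oner_eq0.
    by rewrite mulf_neq0 // good_scale ?frob_scalar // g_good new_plane_scale
      ?frob_scalar.
  by move=> a b [/(mulIf r_neq0)/(fmorph_inj (in_alg L))].
rewrite cardsX card_nonzero card_good // mulnCA mulnC => /eqP.
by rewrite eqn_pmul2r ?subn_gt0 // => /eqP.
Qed.

Lemma card_new_planes_point (P : {vspace V}) : (P <= S)%VS -> \dim P = 1%N ->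
  #|[set E in new_planes | (P <= E)%VS]| = ((q - 1) * (q ^ 3 + q + 1))%N.
Proof.
move=> PS dimP; rewrite -(card_good dimL t_nF t0).
have [y y_neq0 PE] : exists2 y : L, y != 0 &
    forall E : {vspace V}, (P <= E)%VS = (inS y \in E).
  have P_neq0 : P != 0%VS by rewrite -dimv_eq0 dimP.
  have vP := memv_pick P; move: (vP) (P_neq0); rewrite -vpick0.
  move: (vpick P) => [v y] {}vP v_neq0; have := subvP PS _ vP.
  rewrite mem_S /= => /eqP v0; rewrite v0 in vP v_neq0.
  have PE : P = <[inS y]>%VS.
    apply/eqP; rewrite eq_sym eqEdim dimP dim_vline -memvE vP.
    by rewrite /inS v_neq0.
  exists y; first by apply: contraNneq v_neq0 => ->.
  by move=> E; rewrite PE memvE.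
have [d d_neq0 d_ker] : exists2 d : L, d != 0 & d + frob d == 0.
  exists (vpick (lker (frobD1 L))); last by rewrite -frobD1E -memv_ker memv_pick.
  by rewrite vpick0 -dimv_eq0 dim_ker_frobD1.
(* This choice makes [y / rho = d]. Every new plane through [y] can be rescaled to this [rho], and
   [g] then ranges freely and injectively over the good values. *)
pose rho := y / d; have rho_neq0 : rho != 0 by rewrite mulf_neq0 ?invr_eq0.
have yE g : inS y \in new_plane rho g.
  rewrite mem_new_plane // /in_new /base /= !linear0 !eqxx /= mulr0.
  by rewrite /rho invf_div mulrCA divff // mulr1.
rewrite -(card_in_imset (f := fun g : finL => new_plane rho g)) => [|g h].
  apply: eq_card => E; rewrite inE PE; apply/andP/imsetP.
    case=> /new_planesP[sig [g [sig_neq0 g_good ->]]] /[dup] yg.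
    case/(new_plane_point y_neq0 rho_neq0 sig_neq0 (yE g)) => c [c_neq0 fc ->].
    exists (c^-1 * g).
      by rewrite inE good_scale ?invr_eq0 // fmorphV /= fc.
    by rewrite -[RHS](new_plane_scale dimL _ _ fc c_neq0) mulVKf.
  case=> g; rewrite inE => g_good ->; split=> //.
  by apply/new_planesP; exists rho, g.
rewrite !inE => g_good h_good /(new_plane_eq dimL).
case/(_ rho_neq0 rho_neq0 (good_nF g_good) (good_nF h_good)) => c [_ _ + ->].
by rewrite -[LHS]mul1r => /(mulIf rho_neq0) <-; rewrite mul1r.
Qed.

Lemma dim_new_planes E :
  E \in new_planes -> \dim E = 3%N /\ \dim (E :&: S) = 1%N.
Proof.
case/new_planesP=> rho [g [rho_neq0 /good_nF g_nF ->]].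
by rewrite dim_new_plane // dim_capS_new_plane.
Qed.

Lemma disjoint_new_planes_L0 : [disjoint new_planes & L0].
Proof.
rewrite disjoints_subset; apply/subsetP=> E /dim_new_planes[_ dimES].
rewrite inE; apply/L0P=> -[a0 [a1 [EE _]]].
by move: dimES; rewrite EE Gamma_capS dimv0.
Qed.

Lemma plane_code_new : plane_code (L0 :|: new_planes).
Proof.
split=> [E|E E'].
  by case/setUP=> [/L0P[a0 [a1 [-> _]]]|/dim_new_planes[]] //; rewrite dim_Gamma.
case/setUP=> [/L0P[a0 [a1 [-> nr]]]|/new_planesP[rho [g [rho_neq0 g_good ->]]]].
  case/setUP=> [/L0P[b0 [b1 [-> _]]] neq|/new_planesP[sig [h [? h_good ->]]] _].
    by apply: gab_code => //; apply: contraNneq neq => ->.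
  by rewrite capvC; apply: new_gab_code => //; apply: good_nF.
case/setUP=> [/L0P[b0 [b1 [-> nr]]] _|/new_planesP[sig [h [sig_neq0 h_good ->]]]].
  by apply: new_gab_code => //; apply: good_nF.
exact: (new_code dimL t_nF).
Qed.

Lemma Sigma_invariant_new : Sigma_invariant (L0 :|: new_planes).
Proof.
apply: Sigma_invariant_stable => r E r_neq0 /setUP[EL|].
  by apply/setUP; left; apply: sigma_L0.
case/new_planesP=> rho [g [rho_neq0 g_good ->]]; apply/setUP; right.
rewrite sigma_new_plane //; apply/new_planesP; exists (r * rho), g.
by split=> //; apply: mulf_neq0.
Qed.

End New.

End Code.

Local Close Scope ring_scope.

Theorem theorem5p4 (F : finFieldType) (L : fieldExtType F) (q : nat) :
  #|F| = q -> \dim {: L} = 4 ->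
  #|L0 L| = q ^ 8 - q ^ 7 + q ^ 3 /\
  exists N : {set {vspace V L}},
    [/\ [disjoint N & L0 L],
        #|N| = (q ^ 4 - 1) * (q ^ 3 + q + 1),
        (forall E, E \in N -> \dim E = 3 /\ \dim (E :&: S L) = 1),
        (forall P : {vspace V L}, (P <= S L)%VS -> \dim P = 1 ->
           #|[set E in N | (P <= E)%VS]| = (q - 1) * (q ^ 3 + q + 1)) &
        [/\ plane_code (L0 L :|: N),
            #|L0 L :|: N| = q ^ 8 + q ^ 5 + q ^ 4 - q - 1
          & Sigma_invariant (L0 L :|: N)]].
Proof.
move=> <- dimL; split; first exact: card_L0.
have [t [t_nF t0]] := exists_skew_disc0 dimL.
have disj := disjoint_new_planes_L0 dimL t.
exists (new_planes t); split=> //.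
- exact: card_new_planes.
- exact: dim_new_planes.
- exact: card_new_planes_point.
split; [exact: plane_code_new | | exact: Sigma_invariant_new].
rewrite cardsU disjoint_setI0 1?disjoint_sym // cards0 subn0.
rewrite card_L0 // card_new_planes //; have := finNzRing_gt1 F.
case: #|F| => // m _; rewrite !expnS expn0; nia.
Qed.
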